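(* Let $e$ be a positive integer and $p$ a prime. Then \[ \max_n g_n(p^e) \ge \begin{cases} p^{\frac{e^2}{8}} & \text{if } e \equiv 0 \pmod{4}, \\ p^{\frac{1}{8}(e^2-1)} & \text{if } e \equiv 1 \pmod{4}, \\ p^{\frac{1}{8}(e^2-4)} & \text{if } e \equiv 2 \pmod{4}, \\ p^{\frac{1}{8}(e^2-1)} & \text{if } e \equiv 3 \pmod{4}, \end{cases} \] where the maximum is over all positive integers $n$.
   Context: Addition and multiplication on $\mathbb{Z}^n$ are componentwise, and a subring of $\mathbb{Z}^n$ means a multiplicatively closed finite index sublattice containing $(1,\ldots,1)$. A subring $L\subseteq\mathbb{Z}^n$ whose index is a power of the prime $p$ is irreducible if $x_1\equiv x_2\equiv\cdots\equiv x_n \pmod p$ for every $(x_1,\ldots,x_n)\in L$. $g_n(p^e)$ denotes the number of irreducible subrings of $\mathbb{Z}^n$ of index $p^e$. For fixed $e$, $g_n(p^e)=0$ for all but finitely many $n$, so the maximum is well defined. *)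

(* Defs.v *)
From HB Require Import structures.
From mathcomp Require Import all_boot all_order all_algebra finmap.
From mathcomp Require Import mathcomp_extra boolp classical_sets functions.
From mathcomp Require Import cardinality.

Set Implicit Arguments.
Unset Strict Implicit.
Unset Printing Implicit Defensive.

Import Order.TTheory GRing.Theory Num.Theory.
Local Open Scope classical_set_scope.
Local Open Scope ring_scope.

(* Z^n, with the pointwise ring structure of finite functions. *)
Notation Zn n := {ffun 'I_n -> int}.

Definition cosets n (L : set (Zn n)) : set (set (Zn n)) :=
  [set [set x + y | y in L] | x in [set: Zn n]].

(* As fset_set of an infinite set is empty, this is 0 for infinite index. *)
Definition lattice_index n (L : set (Zn n)) : nat :=
  #|` fset_set (cosets L)|.

(* [subring_closed] contains 1, i.e. (1,...,1), and closure under subtraction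
   and multiplication. *)
Definition is_subring n (L : set (Zn n)) : Prop :=
  GRing.subring_closed (mem L) /\ finite_set (cosets L).

Definition irreducible_subring (p n : nat) (L : set (Zn n)) : Prop :=
  [/\ is_subring L,
      exists f : nat, lattice_index L = (p ^ f)%N &
      forall x, L x -> forall i j : 'I_n, (x i = x j %[mod p%:Z])%Z].

(* The number g_n(p^e), as a function of n, p and e. *)
Definition g (n p e : nat) : nat :=
  #|` fset_set [set L : set (Zn n) |
        irreducible_subring p L /\ lattice_index L = (p ^ e)%N]|.

Definition is_max (A : set nat) (M : nat) : Prop := A M /\ ubound A M.

(* Main.v *)
Require Import Defs.
From mathcomp Require Import all_boot all_algebra finmap.
From mathcomp Require Import boolp classical_sets functions cardinality.
From mathcomp Require Import zify ring.

(* The lower bound comes from the lattices between Z 1 + p^2 Z^n and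
   Z 1 + p Z^n: each of them is multiplicatively closed, because the product of
   two elements of p Z^n lies in p^2 Z^n, so they correspond to the subspaces
   of F_p^(n-1).  Subspaces of codimension k give subrings of index
   p^(n-1+k), and the graphs of linear maps F_p^(n-1-k) -> F_p^k already
   provide p^(k(n-1-k)) of them; one takes k = (e+1)/4 rounded down and
   n = e-k+1.  The maximum exists because an irreducible subring is contained
   in Z 1 + p Z^n, whose index is p^(n-1), and because Z^n has finitely many
   sublattices of a given index N, as all of them contain N! Z^n. *)

Set Implicit Arguments.
Unset Strict Implicit.
Unset Printing Implicit Defensive.

Import GRing.Theory Num.Theory.
Local Open Scope classical_set_scope.
Local Open Scope ring_scope.

(** * Counting by injections, and residues of integers *)

Lemma finite_range_finType (T : finType) (U : Type) (f : T -> U) :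
  finite_set (range f).
Proof. exact: finite_image. Qed.

Lemma leq_card_fset_set (T : finType) (U : choiceType) (f : T -> U)
    (B : set U) :
  finite_set B -> injective f -> (forall t, B (f t)) ->
  (#|T| <= #|` fset_set B|)%N.
Proof.
move=> finB injf fB; rewrite cardE -(size_map f).
apply: uniq_leq_size; first by rewrite map_inj_uniq ?enum_uniq.
by move=> _ /mapP[t _ ->]; have /mem_set := fB t; rewrite -in_fset_set.
Qed.

Lemma card_fset_set_range (T : finType) (U : choiceType) (f : T -> U) :
  injective f -> #|` fset_set (range f)| = #|T|.
Proof.
move=> injf; have finR := finite_range_finType f.
apply/eqP; rewrite eqn_leq (leq_card_fset_set finR injf) ?andbT; last first.
  by move=> t; exists t.
rewrite cardE -(size_map f); apply: uniq_leq_size; first exact: fset_uniq.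
move=> y yf; have : y \in fset_set (range f) by [].
by rewrite in_fset_set // inE => -[t _ <-]; rewrite map_f ?mem_enum.
Qed.

Lemma int_residue (d : nat) (x : int) :
  (0 < d)%N -> exists k : 'I_d, (d%:Z %| x - (k : nat)%:Z)%Z.
Proof.
move=> d_gt0; have dn0 : d%:Z != 0 by case: d d_gt0.
have lt : (`|(x %% d%:Z)%Z| < d)%N.
  by rewrite -ltz_nat gez0_abs ?modz_ge0 // ltz_pmod.
exists (Ordinal lt) => /=; rewrite gez0_abs ?modz_ge0 //.
by apply/dvdzP; exists (x %/ d%:Z)%Z; rewrite {1}(divz_eq x d%:Z) addrK.
Qed.

Lemma int_residue_inj (d : nat) (k l : 'I_d) :
  (d%:Z %| (k : nat)%:Z - (l : nat)%:Z)%Z -> k = l.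
Proof.
rewrite -eqz_mod_dvd => /eqP; rewrite !modz_nat !modn_small // => -[] /val_inj.
exact.
Qed.

(** * Cosets and index of a sublattice *)

Section Sublattices.
Variables (n : nat) (L : set (Zn n)).
Hypothesis zmodL : GRing.zmod_closed (mem L).

Lemma lattice0 : L 0.
Proof. by case: zmodL => /set_mem. Qed.

Lemma latticeB x y : L x -> L y -> L (x - y).
Proof.
by case: zmodL => _ LB Lx Ly; apply/set_mem/LB; apply/mem_set.
Qed.

Lemma latticeD x y : L x -> L y -> L (x + y).
Proof.
move=> Lx Ly; rewrite -[y]opprK -[- y]sub0r.
by apply/latticeB => //; apply/latticeB => //; exact: lattice0.
Qed.

Lemma latticeMn x k : L x -> L (x *+ k).
Proof.
move=> Lx; elim: k => [|k IHk]; first by rewrite mulr0n; exact: lattice0.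
by rewrite mulrS; exact: latticeD.
Qed.

Lemma coset_eqP x y :
  [set x + z | z in L] = [set y + z | z in L] <-> L (x - y).
Proof.
split=> [/seteqP[/(_ x)] | Lxy].
  case; first by exists 0; [exact: lattice0 | rewrite addr0].
  by move=> z Lz <- _; rewrite addrC addKr.
apply/seteqP; split=> _ [z Lz <-].
  by exists (x - y + z); [exact: latticeD | rewrite addrA (addrC y) subrK].
exists (z - (x - y)); first exact: latticeB.
by rewrite opprB addrCA (addrC x) subrK addrC.
Qed.

(** Finiteness of the index matters here: an infinite one is recorded as 0. *)
Lemma leq_lattice_index (T : finType) (r : T -> Zn n) :
  finite_set (cosets L) -> (forall s t, L (r s - r t) -> s = t) ->
  (#|T| <= lattice_index L)%N.
Proof.
move=> finL injr.
apply: (@leq_card_fset_set T _ (fun t => [set r t + y | y in L])) => //.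
  by move=> s t /coset_eqP /injr.
by move=> t; exists (r t).
Qed.

Lemma lattice_index_transversal (T : finType) (r : T -> Zn n) :
  (forall s t, L (r s - r t) -> s = t) -> (forall x, exists t, L (x - r t)) ->
  finite_set (cosets L) /\ lattice_index L = #|T|.
Proof.
move=> injr surjr.
have cosetsE : cosets L = range (fun t => [set r t + y | y in L]).
  apply/seteqP; split=> _ [x _ <-]; last by exists (r x).
  by have [t Lt] := surjr x; exists t => //; apply/esym/coset_eqP.
rewrite /lattice_index cosetsE; split; first exact: finite_range_finType.
by apply: card_fset_set_range => s t /coset_eqP /injr.
Qed.

(* Pigeonhole among the cosets of 0, x, ..., N x. *)
Lemma lattice_mul_fact x :
  finite_set (cosets L) -> L (x *+ (lattice_index L)`!).
Proof.
move=> finL; set N := lattice_index L; apply: contrapT => nLx.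
suff /(@leq_lattice_index 'I_N.+1 (fun i => x *+ i) finL) : forall i j : 'I_N.+1,
    L (x *+ i - x *+ j) -> i = j by rewrite card_ord ltnn.
suff lt_ij (i j : 'I_N.+1) : (i < j)%N -> ~ L (x *+ j - x *+ i).
  move=> i j Lij; apply: val_inj; case: (ltngtP i j) => // ij; exfalso.
    apply: (lt_ij i j ij); rewrite -opprB -sub0r.
    by apply: latticeB => //; exact: lattice0.
  exact: (lt_ij j i ij).
move=> ij; rewrite -mulrnBr ?(ltnW ij) // => Lij; apply: nLx.
(* As 0 < j - i <= N, the factor j - i divides N!. *)
have /dvdnP[q ->] : (j - i %| N`!)%N.
  by apply: dvdn_fact; rewrite subn_gt0 ij /= leq_subLR; have := ltn_ord j; lia.
by rewrite mulnC mulrnA; exact: latticeMn.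
Qed.

End Sublattices.

(** * Finiteness of the families counted by [g], and vanishing for large n *)

Lemma finite_sublattices (n N : nat) :
  finite_set [set L : set (Zn n) |
    [/\ GRing.zmod_closed (mem L), finite_set (cosets L) &
        lattice_index L = N]].
Proof.
pose T := {ffun 'I_n -> 'I_(N`!)}.
pose emb (t : T) : Zn n := [ffun i => (t i : nat)%:Z].
have residue (x : Zn n) : exists t, exists y, x = emb t + y *+ N`!.
  have /fin_all_exists[t dvd_t] i := int_residue (x i) (fact_gt0 N).
  have /fin_all_exists[y yP] i := elimT dvdzP (dvd_t i).
  exists (finfun t), (finfun y); apply/ffunP=> i.
  rewrite !ffunE ffunMnE ffunE -mulr_natr natz -yP; ring.
(* A lattice containing N! Z^n is a union of cosets of N! Z^n, so it is [F S] for the set S of those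
   vectors reduced modulo N! that it contains. *)
pose F (S : {set T}) : set (Zn n) :=
  [set x | exists2 t, t \in S & exists y, x = emb t + y *+ N`!].
apply: sub_finite_set (finite_range_finType F) => L /= [zmodL finL indL].
exists [set t : T | `[< L (emb t) >]]%SET => //.
have LN y : L (y *+ N`!) by rewrite -indL; exact: lattice_mul_fact.
apply/seteqP; split=> x /=.
  move=> [t]; rewrite inE => /asboolP Lt [y ->]; exact: latticeD.
move=> Lx; have [t [y xE]] := residue x; exists t; last by exists y.
rewrite inE; apply/asboolP; have -> : emb t = x - y *+ N`!.
  by rewrite xE addrK.
exact: latticeB.
Qed.

Lemma subring_zmod_closed n (L : set (Zn n)) :
  is_subring L -> GRing.zmod_closed (mem L).
Proof. by case=> subL _; exact: GRing.subring_closedB subL. Qed.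

Lemma finite_irreducible_subrings n p e :
  finite_set [set L : set (Zn n) |
    irreducible_subring p L /\ lattice_index L = (p ^ e)%N].
Proof.
apply: sub_finite_set (@finite_sublattices n (p ^ e)) => L /=.
by move=> [[subL _ _] indL]; split=> //; [exact: subring_zmod_closed | case: subL].
Qed.

(** The p^m vectors with first coordinate 0 and the others in [0, p) lie in distinct cosets: a
    difference of two that is in L has all its coordinates congruent to 0 modulo p. *)
Lemma irreducible_index_ge (m p : nat) (L : set (Zn m.+1)) :
  irreducible_subring p L -> (p ^ m <= lattice_index L)%N.
Proof.
move=> [subL _ irrL]; have zmodL := subring_zmod_closed subL.
pose r (t : {ffun 'I_m -> 'I_p}) : Zn m.+1 :=
  [ffun i => if unlift ord0 i is Some j then (t j : nat)%:Z else 0].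
rewrite -[X in (X ^ _)%N]card_ord -[m in (_ ^ m)%N]card_ord -card_ffun.
apply: (leq_lattice_index zmodL (r := r)); first by case: subL.
move=> s t /irrL congr; apply/ffunP=> j; apply: int_residue_inj.
have /eqP := congr (lift ord0 j) ord0.
by rewrite eqz_mod_dvd !ffunE liftK unlift_none subrr subr0.
Qed.

Lemma g_eq0 (m p e : nat) : (1 < p)%N -> (e < m)%N -> g m.+1 p e = 0%N.
Proof.
move=> p_gt1 lt_em; rewrite /g (_ : [set _ | _] = set0) ?fset_set0 //.
apply/seteqP; split=> // L [/irreducible_index_ge + indL] /=.
by rewrite indL leq_exp2l // leqNgt lt_em.
Qed.

(** * Subrings attached to graphs of matrices modulo p *)

Section GraphSubrings.
Variables (p a k : nat).
Hypothesis p_gt1 : (1 < p)%N.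
Implicit Types (A : 'M['I_p]_(k, a)) (x y : Zn (a + k).+1).

(** Subtracting x_0 1 from x kills the coordinate [ord0]; the remaining ones split into a block of
    length a and a block of length k. The graph of A has the equation [defect A x] = 0. *)
Let lcoord x (l : 'I_a) : int := x (lift ord0 (lshift k l)) - x ord0.
Let rcoord x (j : 'I_k) : int := x (lift ord0 (rshift a j)) - x ord0.
Let defect A x (j : 'I_k) : int :=
  rcoord x j - \sum_l (A j l : nat)%:Z * lcoord x l.

Let vec (u : 'I_a -> int) (v : 'I_k -> int) : Zn (a + k).+1 :=
  [ffun i => if unlift ord0 i is Some i' then
               match fintype.split (i' : 'I_(a + k)) with
               | inl l => u l | inr j => v j
               end
             else 0 : int].

(* The preimage in Z 1 + p Z^n of the graph of the matrix A modulo p. *)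
Definition graph_subring A : set (Zn (a + k).+1) :=
  [set x | (forall l, (p%:Z %| lcoord x l)%Z) /\
           (forall j, ((p ^ 2)%N%:Z %| defect A x j)%Z)].

Let lcoord_vec u v l : lcoord (vec u v) l = u l.
Proof.
by rewrite /lcoord !ffunE liftK unlift_none (fintype.unsplitK (inl l)) subr0.
Qed.

Let rcoord_vec u v j : rcoord (vec u v) j = v j.
Proof.
by rewrite /rcoord !ffunE liftK unlift_none (fintype.unsplitK (inr j)) subr0.
Qed.

Let lcoordB x y l : lcoord (x - y) l = lcoord x l - lcoord y l.
Proof. by rewrite /lcoord !ffunE; ring. Qed.

Let defectB A x y j : defect A (x - y) j = defect A x j - defect A y j.
Proof.
rewrite /defect /rcoord !ffunE.
under eq_bigr do rewrite lcoordB mulrBr.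
by rewrite big_split /= sumrN; ring.
Qed.

(** Write x = x_0 1 + x' and y = y_0 1 + y'. Then xy - x_0 y_0 1 = x_0 y' + y_0 x' + x' y', and only
    the last term is not linear in x' or y' alone. *)
Let lcoordM x y l :
  lcoord (x * y) l =
    x ord0 * lcoord y l + y ord0 * lcoord x l + lcoord x l * lcoord y l.
Proof. by rewrite /lcoord !ffunE; ring. Qed.

Let defectM A x y j :
  defect A (x * y) j =
    x ord0 * defect A y j + y ord0 * defect A x j + rcoord x j * rcoord y j
    - \sum_l (A j l : nat)%:Z * (lcoord x l * lcoord y l).
Proof.
rewrite /defect /rcoord !ffunE.
under eq_bigr do rewrite lcoordM 2!mulrDr !(mulrCA (nat_of_ord _)%:Z (_ ord0)).
by rewrite !big_split /= -!mulr_sumr; ring.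
Qed.

Let rcoord_dvd A x j : graph_subring A x -> (p%:Z %| rcoord x j)%Z.
Proof.
move=> [Lx Dx]; have -> : rcoord x j =
  defect A x j + \sum_l (A j l : nat)%:Z * lcoord x l by rewrite subrK.
apply: rpredD; first by apply: dvdz_trans (Dx j); rewrite dvdzE dvdn_exp.
by apply: rpred_sum => l _; exact: dvdz_mull.
Qed.

Lemma graph_subring_closed A : GRing.subring_closed (mem (graph_subring A)).
Proof.
have sqrE : (p ^ 2)%N%:Z = p%:Z * p%:Z by rewrite -PoszM.
split=> [|x y /set_mem Gx /set_mem Gy|x y /set_mem Gx /set_mem Gy].
- apply: mem_set; split=> [l|j]; first by rewrite /lcoord !ffunE subrr dvdz0.
  rewrite /defect /rcoord !ffunE subrr big1 ?subrr ?dvdz0 // => l _.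
  by rewrite /lcoord !ffunE subrr mulr0.
- case: Gx Gy => [Lx Dx] [Ly Dy].
  by apply: mem_set; split=> [l|j]; rewrite ?lcoordB ?defectB rpredB.
- have [[Lx Dx] [Ly Dy]] := (Gx, Gy).
  apply: mem_set; split=> [l|j].
    by rewrite lcoordM !rpredD // dvdz_mull.
  (* The quadratic terms are products of two multiples of p, hence vanish modulo p^2; the others are
     multiples of the defects of x and y. *)
  rewrite defectM; apply: rpredB; last first.
    by apply: rpred_sum => l _; rewrite dvdz_mull // sqrE dvdz_mul.
  apply: rpredD; first by rewrite rpredD // dvdz_mull.
  by rewrite sqrE dvdz_mul //; [apply: rcoord_dvd Gx | apply: rcoord_dvd Gy].
Qed.

(** A coset is determined by the a left coordinates modulo p and the k defects modulo p^2, and all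
    these values occur. *)
Lemma graph_subring_index A :
  finite_set (cosets (graph_subring A)) /\
  lattice_index (graph_subring A) = (p ^ (a + k.*2))%N.
Proof.
have p2_gt0 : (0 < p ^ 2)%N by rewrite expn_gt0 ltnW.
pose T := ({ffun 'I_a -> 'I_p} * {ffun 'I_k -> 'I_(p ^ 2)})%type.
pose r (t : T) := vec (fun l => (t.1 l : nat)%:Z)
  (fun j => (t.2 j : nat)%:Z + \sum_l (A j l : nat)%:Z * (t.1 l : nat)%:Z).
have lcoord_r t l : lcoord (r t) l = (t.1 l : nat)%:Z by rewrite lcoord_vec.
have defect_r t j : defect A (r t) j = (t.2 j : nat)%:Z.
  rewrite /defect rcoord_vec; under [X in _ - X]eq_bigr do rewrite lcoord_r.
  by rewrite addrK.
have -> : (p ^ (a + k.*2))%N = #|{: T}|.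
  by rewrite card_prod !card_ffun !card_ord -expnM mul2n expnD.
have zmodG := GRing.subring_closedB (graph_subring_closed A).
apply: (lattice_index_transversal zmodG (r := r)).
- move=> [s1 s2] [t1 t2] [Lst Dst]; congr pair; apply/ffunP=> i.
    by apply: int_residue_inj; have := Lst i; rewrite lcoordB !lcoord_r.
  by apply: int_residue_inj; have := Dst i; rewrite defectB !defect_r.
move=> x.
have /fin_all_exists[t1 t1P] l := int_residue (lcoord x l) (ltnW p_gt1).
have /fin_all_exists[t2 t2P] j := int_residue (defect A x j) p2_gt0.
exists (finfun t1, finfun t2); split=> i.
  by rewrite lcoordB lcoord_r ffunE.
by rewrite defectB defect_r ffunE.
Qed.

Lemma graph_subring_irreducible A : irreducible_subring p (graph_subring A).
Proof.
have [finA indA] := graph_subring_index A.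
split; first by split=> //; exact: graph_subring_closed.
  by exists (a + k.*2)%N.
move=> x Gx.
suff x0 i : (x i = x ord0 %[mod p%:Z])%Z by move=> i j; rewrite x0 [RHS]x0.
apply/eqP; rewrite eqz_mod_dvd.
case: (unliftP ord0 i) => [i'|] ->; last by rewrite subrr dvdz0.
rewrite -(fintype.splitK i'); case: (fintype.split i') => [l|j] /=.
  by case: Gx => /(_ l).
exact: rcoord_dvd j Gx.
Qed.

(** The vector with left block p e_l and right block A (p e_l) lies in the subring of A. Its defects
    for B are p (A_jl - B_jl), so if it also lies in the subring of B, then p divides A_jl -
    B_jl. *)
Lemma graph_subring_inj : injective graph_subring.
Proof.
move=> A B eqAB; apply/matrixP=> j l; apply: int_residue_inj.
pose u l' : int := if l' == l then p%:Z else 0.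
pose x := vec u (fun j' => \sum_l' (A j' l' : nat)%:Z * u l').
have defect_x C j' :
  defect C x j' = ((A j' l : nat)%:Z - (C j' l : nat)%:Z) * p%:Z.
  rewrite /defect rcoord_vec.
  under [X in _ - X]eq_bigr do rewrite lcoord_vec.
  rewrite -sumrB (bigD1 l) //= big1 ?addr0 => [|l' /negPf nl].
    by rewrite /u eqxx mulrBl.
  by rewrite /u nl !mulr0 subrr.
have : graph_subring A x.
  split=> [l'|j']; last by rewrite defect_x subrr mul0r dvdz0.
  by rewrite lcoord_vec /u; case: eqP; rewrite ?dvdzz ?dvdz0.
rewrite eqAB => -[_ /(_ j)]; rewrite defect_x -mulnn PoszM dvdz_mul2r //.
by rewrite -lt0n ltnW.
Qed.

Lemma g_ge : (p ^ (k * a) <= g (a + k).+1 p (a + k.*2))%N.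
Proof.
rewrite -[X in (X ^ _)%N]card_ord -card_mx.
apply: leq_card_fset_set graph_subring_inj _.
  exact: finite_irreducible_subrings.
move=> A; split; first exact: graph_subring_irreducible.
by case: (graph_subring_index A).
Qed.

End GraphSubrings.

(* Existence of the maximum and choice of the parameters *)
Local Close Scope ring_scope.
Local Open Scope nat_scope.

(* The divisions by 8 are exact in the respective congruence classes. *)
Theorem corollary4p2 (e p : nat) (he : 0 < e) (hp : prime p) :
  exists2 M : nat,
    is_max [set g n p e | n in [set n : nat | 0 < n]] M &
    [/\ e = 0 %[mod 4] -> p ^ (e ^ 2 %/ 8) <= M,
        e = 1 %[mod 4] -> p ^ ((e ^ 2 - 1) %/ 8) <= M,
        e = 2 %[mod 4] -> p ^ ((e ^ 2 - 4) %/ 8) <= M &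
        e = 3 %[mod 4] -> p ^ ((e ^ 2 - 1) %/ 8) <= M].
Proof.
have p_gt1 := prime_gt1 hp.
(* The values at n > e + 1 are 0, so n = m + 1 with m <= e suffices. *)
pose M := \max_(m < e.+1) g m.+1 p e.
have M_ge n : 0 < n -> g n p e <= M.
  case: n => // m _; have [le_me|lt_em] := leqP m e; last by rewrite g_eq0.
  exact: (leq_bigmax (Ordinal (le_me : m < e.+1))).
exists M.
  split=> [|_ [n n_gt0 <-]]; last exact: M_ge.
  rewrite /M; have [|m ->] := @eq_bigmax _ (fun m : 'I_e.+1 => g m.+1 p e).
    by rewrite card_ord.
  by exists m.+1.
have M_graph a k q : e = a + k.*2 -> q = k * a -> p ^ q <= M.
  by move=> eE ->; apply: leq_trans (M_ge _ (ltn0Sn (a + k))); rewrite eE g_ge.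
have exp8 q r : q * 8 = r -> r %/ 8 = q by move=> <-; rewrite mulnK.
have eE := divn_eq e 4; set q := e %/ 4 in eE.
clearbody q; split=> e4; rewrite e4 modn_small // in eE.
(* With a = e - 2k the exponent is k (e - 2k), largest for k an integer nearest to e/4. That is q
   for remainders 0, 1 and 2 (tied with q + 1 for 2), and q + 1 for remainder 3. *)
- apply: (M_graph (q * 2) q); first by lia.
  by apply: exp8; rewrite eE -mulnn; nia.
- apply: (M_graph (q * 2 + 1) q); first by lia.
  by apply: exp8; rewrite eE -mulnn; nia.
- apply: (M_graph (q * 2 + 2) q); first by lia.
  by apply: exp8; rewrite eE -mulnn; nia.
- apply: (M_graph (q * 2 + 1) q.+1); first by lia.
  by apply: exp8; rewrite eE -mulnn; nia.
Qed.
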